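(* Let $1\to N\to G\xrightarrow{q} H\to 1$ be a short exact sequence of (discrete) groups, with $N$ regarded as a normal subgroup of $G$, let $\sigma:H\to G$ be a normalized section of $q$, and let $(\bar S,\bar\omega)$ be the associated $(\mathbb{C}[N],H)$-crossed system. Suppose that $\mathbb{C}[N]$ is a domain and that $H$ is a unique product group. Then $\mathbb{C}[N]\times_{(\bar S,\bar\omega)}H$ is a domain.
   Context: A domain is a nonzero unital, not necessarily commutative, ring in which the product of any two nonzero elements is nonzero. A group $H$ is a unique product group if for any two non-empty finite subsets $A,B\subseteq H$ there exists at least one element $h\in H$ which has a unique representation of the form $h=ab$ with $a\in A$ and $b\in B$. For a group $G$, $\mathbb{C}[G]$ is the complex group ring (finitely supported functions $G\to\mathbb{C}$) with convolution product $\star$; $\delta_g$ is the Dirac function at $g\in G$. A section $\sigma:H\to G$ of $q$ is a map with $q\circ\sigma=\mathrm{id}_H$; it is normalized if $\sigma(e_H)=e_G$. Put $\omega(h,h'):=\sigma(h)\sigma(h')\sigma(hh')^{-1}\in N$ for $h,h'\in H$. Define $\bar S:H\to\mathrm{Aut}(\mathbb{C}[N])$ by $\bar S(h)(f):=\delta_{\sigma(h)}\star f\star\delta_{\sigma(h)^{-1}}$ and $\bar\omega:H\times H\to\mathbb{C}[N]^\times$ by $\bar\omega(h,h'):=\delta_{\omega(h,h')}$. The crossed product $\mathbb{C}[N]\times_{(\bar S,\bar\omega)}H$ is the vector space $\bigoplus_{h\in H}\mathbb{C}[N]d_h$ (the free left $\mathbb{C}[N]$-module with basis $(d_h)_{h\in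 H}$) with the bilinear multiplication determined by $$fd_h\bullet f'd_{h'}:=f\star\bar S(h)(f')\star\bar\omega(h,h')\,d_{hh'},\qquad f,f'\in\mathbb{C}[N],\ h,h'\in H;$$ it is a unital associative algebra with identity $d_e$. *)

(* Defs.v *)
From HB Require Import structures.
From mathcomp Require Import all_boot all_order all_algebra.
From mathcomp Require Import finmap complex reals monalg.

Set Implicit Arguments.
Unset Strict Implicit.
Unset Printing Implicit Defensive.

Import GRing.Theory.
Local Open Scope fset_scope.
Local Open Scope ring_scope.

Definition is_domain (A : pzRingType) : Prop :=
  (1 : A) != 0 /\ forall x y : A, x != 0 -> y != 0 -> x * y != 0.

Definition unique_product_group (H : groupType) : Prop :=
  forall A B : {fset H}, A != fset0 -> B != fset0 ->
    exists h : H, exists! ab : H * H,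
      [/\ ab.1 \in A, ab.2 \in B & h = (ab.1 * ab.2)%g].

(* Products on {malg A[K]} of the form                                        *)
(*   (\sum_h x_h h) (\sum_k y_k k) = \sum_(h, k) m h k x_h y_k (hk).          *)
Section TwistedProduct.
Variables (K : groupType) (A : nzRingType) (m : K -> K -> A -> A -> A).
Hypothesis mDl : forall h k a a' b, m h k (a + a') b = m h k a b + m h k a' b.
Hypothesis mDr : forall h k a b b', m h k a (b + b') = m h k a b + m h k a b'.
Implicit Types x y z : {malg A[K]}.

Definition tmul x y : {malg A[K]} :=
  \sum_(h <- msupp x) \sum_(k <- msupp y) << m h k x@_h y@_k *g (h * k)%g >>.

Let m0l h k b : m h k 0 b = 0.
Proof. by apply: (addrI (m h k 0 b)); rewrite -mDl !addr0. Qed.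
Let m0r h k a : m h k a 0 = 0.
Proof. by apply: (addrI (m h k a 0)); rewrite -mDr !addr0. Qed.

Lemma tmulw (d1 d2 : {fset K}) x y : msupp x `<=` d1 -> msupp y `<=` d2 ->
  tmul x y =
    \sum_(h <- d1) \sum_(k <- d2) << m h k x@_h y@_k *g (h * k)%g >>.
Proof.
move=> le1 le2; rewrite /tmul (big_fset_incl _ le1) /=.
  apply/eq_bigr=> h _; apply/big_fset_incl => // k _ /mcoeff_outdom ->.
  by rewrite m0r monalgU0.
move=> h _ /mcoeff_outdom xh.
by rewrite big1 // => k _; rewrite xh m0l monalgU0.
Qed.

Lemma tmulDl : left_distributive tmul +%R.
Proof.
move=> x y z.
rewrite (tmulw (msuppD_le x y) (fsubset_refl (msupp z))).
rewrite (tmulw (fsubsetUl (msupp x) (msupp y)) (fsubset_refl (msupp z))).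
rewrite (tmulw (fsubsetUr (msupp x) (msupp y)) (fsubset_refl (msupp z))).
rewrite -big_split /=; apply/eq_bigr=> h _.
rewrite -big_split /=; apply/eq_bigr=> k _.
by rewrite mcoeffD mDl monalgUD.
Qed.

Lemma tmulDr : right_distributive tmul +%R.
Proof.
move=> x y z.
rewrite (tmulw (fsubset_refl (msupp x)) (msuppD_le y z)).
rewrite (tmulw (fsubset_refl (msupp x)) (fsubsetUl (msupp y) (msupp z))).
rewrite (tmulw (fsubset_refl (msupp x)) (fsubsetUr (msupp y) (msupp z))).
rewrite -big_split /=; apply/eq_bigr=> h _.
rewrite -big_split /=; apply/eq_bigr=> k _.
by rewrite mcoeffD mDr monalgUD.
Qed.

Lemma tmulUU a b h k :
  tmul << a *g h >> << b *g k >> = << m h k a b *g (h * k)%g >>.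
Proof. by rewrite (tmulw msuppU_le msuppU_le) !big_seq_fset1 !mcoeffUU. Qed.

Lemma tmul0l x : tmul 0 x = 0.
Proof. by apply: (addrI (tmul 0 x)); rewrite -tmulDl !addr0. Qed.
Lemma tmul0r x : tmul x 0 = 0.
Proof. by apply: (addrI (tmul x 0)); rewrite -tmulDr !addr0. Qed.

Lemma tmul_suml I (r : seq I) (F : I -> {malg A[K]}) y :
  tmul (\sum_(i <- r) F i) y = \sum_(i <- r) tmul (F i) y.
Proof.
exact: (big_morph (tmul^~ y) (fun u v => tmulDl u v y) (tmul0l y)).
Qed.
Lemma tmul_sumr I (r : seq I) (F : I -> {malg A[K]}) y :
  tmul y (\sum_(i <- r) F i) = \sum_(i <- r) tmul y (F i).
Proof. exact: (big_morph (tmul y) (tmulDr y) (tmul0r y)). Qed.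

Hypothesis mA : forall h k l a b c,
  m h (k * l)%g a (m k l b c) = m (h * k)%g l (m h k a b) c.
Hypothesis m1l : forall k b, m 1%g k 1 b = b.
Hypothesis m1r : forall k b, m k 1%g b 1 = b.

Lemma tmulA : associative tmul.
Proof.
move=> x y z; rewrite [x]monalgE !tmul_suml; apply: eq_bigr => h _.
rewrite [y]monalgE tmul_suml !tmul_sumr tmul_suml; apply: eq_bigr => k _.
rewrite [z]monalgE !tmul_sumr; apply: eq_bigr => l _.
by rewrite !tmulUU mA mulgA.
Qed.

Lemma tmul1l : left_id << 1 *g 1%g >> tmul.
Proof.
move=> x; rewrite [x]monalgE tmul_sumr; apply: eq_bigr => k _.
by rewrite tmulUU m1l mul1g.
Qed.

Lemma tmul1r : right_id << 1 *g 1%g >> tmul.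
Proof.
move=> x; rewrite [x]monalgE tmul_suml; apply: eq_bigr => k _.
by rewrite tmulUU m1r mulg1.
Qed.

Lemma tone_neq0 : << 1 *g 1%g >> != 0 :> {malg A[K]}.
Proof. by rewrite monalgU_eq0 oner_eq0. Qed.

End TwistedProduct.

Section GroupRing.
Variables (K : nzRingType) (G : groupType).

(* Finitely supported functions G -> K; << c *g x >> is c delta_x, and f@_x is *)
(* the value of f at x.                                                        *)
Definition group_ring : Type := {malg K[G]}.

HB.instance Definition _ := GRing.Lmodule.copy group_ring {malg K[G]}.

Definition group_ring_mul (f g : group_ring) : group_ring :=
  \sum_(x <- msupp f) \sum_(y <- msupp g) << f@_x * g@_y *g (x * y)%g >>.

Definition delta (x : G) : group_ring := << 1 *g x >>.

Let m (x y : G) (a b : K) := a * b.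
Let mDl x y a a' b : m x y (a + a') b = m x y a b + m x y a' b.
Proof. exact: mulrDl. Qed.
Let mDr x y a b b' : m x y a (b + b') = m x y a b + m x y a b'.
Proof. exact: mulrDr. Qed.
Let mA x y z a b c : m x (y * z)%g a (m y z b c) = m (x * y)%g z (m x y a b) c.
Proof. exact: mulrA. Qed.
Let m1l x a : m 1%g x 1 a = a. Proof. exact: mul1r. Qed.
Let m1r x a : m x 1%g a 1 = a. Proof. exact: mulr1. Qed.

Lemma group_ring_mulA : associative group_ring_mul.
Proof. exact: tmulA mDl mDr mA. Qed.
Lemma group_ring_mul1l : left_id (delta 1%g) group_ring_mul.
Proof. exact: tmul1l mDl mDr m1l. Qed.
Lemma group_ring_mul1r : right_id (delta 1%g) group_ring_mul.
Proof. exact: tmul1r mDl mDr m1r. Qed.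
Lemma group_ring_mulDl : left_distributive group_ring_mul +%R.
Proof. exact: tmulDl mDl mDr. Qed.
Lemma group_ring_mulDr : right_distributive group_ring_mul +%R.
Proof. exact: tmulDr mDl mDr. Qed.
Lemma group_ring_one_neq0 : delta 1%g != 0.
Proof. exact: tone_neq0. Qed.

HB.instance Definition _ := GRing.Zmodule_isNzRing.Build group_ring
  group_ring_mulA group_ring_mul1l group_ring_mul1r
  group_ring_mulDl group_ring_mulDr group_ring_one_neq0.

Lemma group_ringE (f : group_ring) :
  f = \sum_(x <- msupp f) (<< f@_x *g x >> : group_ring).
Proof. exact: monalgE. Qed.

Lemma mcoeff_group_ring_sum I (r : seq I) (F : I -> group_ring) x :
  (\sum_(i <- r) F i)@_x = \sum_(i <- r) (F i)@_x.
Proof. exact: (raddf_sum (mcoeff x)). Qed.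

Lemma group_ringUU a b x y :
  (<< a *g x >> : group_ring) * << b *g y >> = << a * b *g (x * y)%g >>.
Proof. exact: (tmulUU mDl mDr). Qed.

Lemma deltaE x : delta x = << 1 *g x >>.
Proof. by []. Qed.

Lemma delta1 : delta 1%g = 1.
Proof. by []. Qed.

Lemma deltaM x y : delta (x * y)%g = delta x * delta y.
Proof. by rewrite /delta group_ringUU mulr1. Qed.

Lemma deltaVr x : delta x * delta x^-1%g = 1.
Proof. by rewrite -deltaM mulgV. Qed.

Lemma deltaVl x : delta x^-1%g * delta x = 1.
Proof. by rewrite -deltaM mulVg. Qed.

Lemma deltaVK f x : f * delta x^-1%g * delta x = f.
Proof. by rewrite -mulrA deltaVl mulr1. Qed.

Lemma mcoeff_deltaMl x (f : group_ring) y :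
  (delta x * f)@_y = f@_(x^-1 * y)%g.
Proof.
rewrite [f]group_ringE mulr_sumr !mcoeff_group_ring_sum; apply: eq_bigr => z _.
by rewrite group_ringUU mul1r !mcoeffU (can2_eq (mulKg x) (mulVKg x)).
Qed.

Lemma mcoeff_deltaMr x (f : group_ring) y :
  (f * delta x)@_y = f@_(y * x^-1)%g.
Proof.
rewrite [f]group_ringE mulr_suml !mcoeff_group_ring_sum; apply: eq_bigr => z _.
by rewrite group_ringUU mulr1 !mcoeffU (can2_eq (mulgK x) (mulgVK x)).
Qed.

(* The convolution formula, (f * g)(x) = \sum_y f(y) g(y^-1 x).                *)
Lemma group_ring_convE (f g : group_ring) x :
  (f * g)@_x = \sum_(y <- msupp f) f@_y * g@_(y^-1 * x)%g.
Proof.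
rewrite {1}[f]group_ringE mulr_suml mcoeff_group_ring_sum; apply: eq_bigr => y _.
rewrite {1 2}[g]group_ringE mulr_sumr !mcoeff_group_ring_sum mulr_sumr.
apply: eq_bigr => z _; rewrite group_ringUU !mcoeffU mulrnAr.
by rewrite (can2_eq (mulKg y) (mulVKg y)).
Qed.

End GroupRing.

#[local] Opaque delta group_ring_mul.

Record crossed_system (A : nzRingType) (H : groupType) := CrossedSystem {
  cs_act : H -> {rmorphism A -> A};
  cs_coc : H -> H -> A;
  cs_act_bij : forall h, bijective (cs_act h);
  cs_coc_unit : forall h k,
    exists v, cs_coc h k * v = 1 /\ v * cs_coc h k = 1;
  cs_act_comp : forall h k a,
    cs_act h (cs_act k a) * cs_coc h k = cs_coc h k * cs_act (h * k)%g a;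
  cs_cocycle : forall h k l,
    cs_coc h k * cs_coc (h * k)%g l =
    cs_act h (cs_coc k l) * cs_coc h (k * l)%g;
  cs_act1 : forall a, cs_act 1%g a = a;
  cs_coc1l : forall h, cs_coc 1%g h = 1;
  cs_coc1r : forall h, cs_coc h 1%g = 1
}.

(* The free left A-module on H; << a *g h >> is a d_h. The crossed system is a *)
(* phantom argument, from which the product below is inferred.                 *)
Definition crossed_product (A : nzRingType) (H : groupType)
  (s : crossed_system A H) : Type := {malg A[H]}.

Section CrossedProduct.
Variables (A : nzRingType) (H : groupType) (s : crossed_system A H).

HB.instance Definition _ := GRing.Lmodule.copy (crossed_product s) {malg A[H]}.


Definition crossed_product_mul (x y : crossed_product s) : crossed_product s :=
  \sum_(h <- msupp x) \sum_(k <- msupp y)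
     << x@_h * cs_act s h y@_k * cs_coc s h k *g (h * k)%g >>.

Let m (h k : H) (a b : A) := a * cs_act s h b * cs_coc s h k.
Let mDl h k a a' b : m h k (a + a') b = m h k a b + m h k a' b.
Proof. by rewrite /m !mulrDl. Qed.
Let mDr h k a b b' : m h k a (b + b') = m h k a b + m h k a b'.
Proof. by rewrite /m rmorphD mulrDr mulrDl. Qed.
Let mA h k l a b c : m h (k * l)%g a (m k l b c) = m (h * k)%g l (m h k a b) c.
Proof.
rewrite /m !rmorphM /= -!mulrA; congr (_ * (_ * _)).
by rewrite -cs_cocycle !mulrA cs_act_comp.
Qed.
Let m1l h a : m 1%g h 1 a = a.
Proof. by rewrite /m mul1r cs_act1 cs_coc1l mulr1. Qed.
Let m1r h a : m h 1%g a 1 = a.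
Proof. by rewrite /m rmorph1 cs_coc1r !mulr1. Qed.

Definition crossed_product_one : crossed_product s := << 1 *g 1%g >>.

Lemma crossed_product_mulA : associative crossed_product_mul.
Proof. exact: tmulA mDl mDr mA. Qed.
Lemma crossed_product_mul1l : left_id crossed_product_one crossed_product_mul.
Proof. exact: tmul1l mDl mDr m1l. Qed.
Lemma crossed_product_mul1r : right_id crossed_product_one crossed_product_mul.
Proof. exact: tmul1r mDl mDr m1r. Qed.
Lemma crossed_product_mulDl : left_distributive crossed_product_mul +%R.
Proof. exact: tmulDl mDl mDr. Qed.
Lemma crossed_product_mulDr : right_distributive crossed_product_mul +%R.
Proof. exact: tmulDr mDl mDr. Qed.
Lemma crossed_product_one_neq0 : crossed_product_one != 0.
Proof. exact: tone_neq0. Qed.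

HB.instance Definition _ := GRing.Zmodule_isNzRing.Build (crossed_product s)
  crossed_product_mulA crossed_product_mul1l crossed_product_mul1r
  crossed_product_mulDl crossed_product_mulDr crossed_product_one_neq0.

Lemma crossed_productUU a b h k :
  (<< a *g h >> : crossed_product s) * << b *g k >> =
  << a * cs_act s h b * cs_coc s h k *g (h * k)%g >>.
Proof. exact: (tmulUU mDl mDr). Qed.

End CrossedProduct.

Lemma gmorph1 (G1 G2 : groupType) (f : {multiplicative G1 -> G2}) : f 1%g = 1%g.
Proof. by apply: (mulgI (f 1%g)); rewrite -gmulfM !mulg1. Qed.

Lemma gmorphV (G1 G2 : groupType) (f : {multiplicative G1 -> G2}) g :
  f g^-1%g = (f g)^-1%g.
Proof. by apply: (mulgI (f g)); rewrite -gmulfM !mulgV gmorph1. Qed.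

(* A short exact sequence 1 -> N -> G -> H -> 1.                               *)
Record group_extension (N G H : groupType) := GroupExtension {
  ext_incl : {multiplicative N -> G};
  ext_quo : {multiplicative G -> H};
  ext_incl_inj : injective ext_incl;
  ext_quo_surj : forall h, exists g, ext_quo g = h;
  ext_exact : forall g, ext_quo g = 1%g <-> exists n, ext_incl n = g
}.

Lemma conj_cocycle (A : pzRingType) (s s' t t' u u' x : A) :
  s' * s = 1 -> t' * t = 1 -> u' * u = 1 ->
  s * (t * x * t') * s' * (s * t * u') = s * t * u' * (u * x * u').
Proof.
move=> ss tt uu; rewrite !mulrA -[_ * s' * s]mulrA ss mulr1.
by rewrite -[_ * t' * t]mulrA tt mulr1 -[_ * u' * u]mulrA uu mulr1.
Qed.

Record normalized_section (N G H : groupType) (E : group_extension N G H) :=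
  NormalizedSection {
    sec :> H -> G;
    sec_quo : forall h, ext_quo E (sec h) = h;
    sec1 : sec 1%g = 1%g
  }.

Section Extension.
Variables (K : nzRingType) (N G H : groupType) (E : group_extension N G H).

Lemma ext_exactb g : ext_quo E g == 1%g -> exists n, ext_incl E n == g.
Proof. by move=> /eqP /ext_exact [n <-]; exists n. Qed.

(* An element of the kernel of q seen as an element of N (1 on other inputs).  *)
Definition ext_lift (g : G) : N :=
  if (ext_quo E g == 1%g) =P true is ReflectT qg then xchoose (ext_exactb qg)
  else 1%g.

Lemma ext_liftK g : ext_quo E g = 1%g -> ext_incl E (ext_lift g) = g.
Proof.
move=> /eqP qg; rewrite /ext_lift; case: eqP => [qg'|//].
by apply/eqP; exact: (xchooseP (ext_exactb qg')).
Qed.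

Lemma ext_quo_incl n : ext_quo E (ext_incl E n) = 1%g.
Proof. by apply/ext_exact; exists n. Qed.

Lemma ext_inclK : cancel (ext_incl E) ext_lift.
Proof. by move=> n; apply: (@ext_incl_inj _ _ _ E); rewrite ext_liftK ?ext_quo_incl. Qed.

(* The inclusion K[N] -> K[G], and the restriction of functions from G to N.   *)
Definition gr_incl (f : group_ring K N) : group_ring K G :=
  \sum_(n <- msupp f) << f@_n *g ext_incl E n >>.

Definition gr_restrict (F : group_ring K G) : group_ring K N :=
  \sum_(g <- msupp F | ext_quo E g == 1%g) << F@_g *g ext_lift g >>.

Lemma mcoeff_gr_restrict F n : (gr_restrict F)@_n = F@_(ext_incl E n).
Proof.
rewrite {2}[F]group_ringE /gr_restrict big_mkcond !mcoeff_group_ring_sum.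
apply: eq_bigr => g _; rewrite mcoeffU; case: eqP => qg; last first.
  rewrite mcoeff0; case: eqP => // eg.
  by case: qg; rewrite eg ext_quo_incl.
rewrite mcoeffU; congr (_ *+ nat_of_bool _).
by apply/eqP/eqP => [<-|->]; rewrite ?ext_liftK ?ext_inclK.
Qed.

Lemma mcoeff_gr_incl f g :
  (gr_incl f)@_g = if ext_quo E g == 1%g then f@_(ext_lift g) else 0.
Proof.
rewrite {2}[f]group_ringE /gr_incl [LHS]mcoeff_group_ring_sum; case: eqP => qg.
  rewrite mcoeff_group_ring_sum; apply: eq_bigr => n _; rewrite !mcoeffU.
  congr (_ *+ nat_of_bool _).
  by apply/eqP/eqP => [<-|->]; rewrite ?ext_liftK ?ext_inclK.
apply: big1 => n _; rewrite mcoeffU; case: eqP => // ng.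
by case: qg; rewrite -ng ext_quo_incl.
Qed.

Lemma gr_inclK : cancel gr_incl gr_restrict.
Proof.
move=> f; apply/malgP => n.
by rewrite mcoeff_gr_restrict mcoeff_gr_incl ext_quo_incl eqxx ext_inclK.
Qed.

Lemma gr_incl_inj : injective gr_incl.
Proof. exact: can_inj gr_inclK. Qed.

Lemma gr_inclU a n : gr_incl << a *g n >> = << a *g ext_incl E n >>.
Proof.
apply/malgP => g; rewrite mcoeff_gr_incl !mcoeffU.
case: eqP => qg.
  congr (_ *+ nat_of_bool _).
  by apply/eqP/eqP => [->|<-]; rewrite ?ext_liftK ?ext_inclK.
by case: eqP => // ng; case: qg; rewrite -ng ext_quo_incl.
Qed.

Lemma gr_inclB : {morph gr_incl : x y / x - y}.
Proof.
move=> x y; apply/malgP => g; rewrite mcoeffB !mcoeff_gr_incl mcoeffB.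
by case: ifP; rewrite ?subr0.
Qed.

HB.instance Definition _ :=
  GRing.isZmodMorphism.Build (group_ring K N) (group_ring K G) gr_incl gr_inclB.

Lemma gr_incl_sum I (r : seq I) (F : I -> group_ring K N) :
  gr_incl (\sum_(i <- r) F i) = \sum_(i <- r) gr_incl (F i).
Proof. exact: (raddf_sum gr_incl). Qed.

Lemma gr_incl_delta n : gr_incl (delta K n) = delta K (ext_incl E n).
Proof. by rewrite !deltaE gr_inclU. Qed.

Lemma gr_incl_monoid : monoid_morphism gr_incl.
Proof.
split=> [|x y]; first by rewrite -delta1 gr_incl_delta gmorph1.
rewrite [x]group_ringE mulr_suml !gr_incl_sum mulr_suml.
apply: eq_bigr => n _.
rewrite [y]group_ringE mulr_sumr !gr_incl_sum mulr_sumr.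
apply: eq_bigr => p _.
by rewrite !gr_inclU !group_ringUU gr_inclU gmulfM.
Qed.

HB.instance Definition _ :=
  GRing.isMonoidMorphism.Build (group_ring K N) (group_ring K G)
    gr_incl gr_incl_monoid.

Lemma gr_incl1 : gr_incl 1 = 1.
Proof. exact: rmorph1. Qed.

Lemma gr_inclM x y : gr_incl (x * y) = gr_incl x * gr_incl y.
Proof. exact: rmorphM. Qed.

(* f |-> delta_g * f * delta_(g^-1), computed in K[G].                        *)
Definition gr_conj (g : G) (f : group_ring K N) : group_ring K N :=
  gr_restrict (delta K g * gr_incl f * delta K g^-1%g).

Lemma gr_incl_conj g f :
  gr_incl (gr_conj g f) = delta K g * gr_incl f * delta K g^-1%g.
Proof.
apply/malgP => x; rewrite mcoeff_gr_incl.
case: eqP => [qx|qx]; first by rewrite mcoeff_gr_restrict ext_liftK.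
rewrite mcoeff_deltaMr mcoeff_deltaMl mcoeff_gr_incl; case: eqP => // q1.
case: qx; move: q1; rewrite !gmulfM invgK gmorphV => q1.
apply: (mulgI (ext_quo E g)^-1%g); apply: (mulIg (ext_quo E g)).
by rewrite -mulgA q1 mulg1 mulVg.
Qed.

#[local] Opaque gr_incl gr_restrict gr_conj.

Section Conj.
Variables (g : G) (c : group_ring K N -> group_ring K N).
Hypothesis cE : forall f,
  gr_incl (c f) = delta K g * gr_incl f * delta K g^-1%g.

Let cB : {morph c : x y / x - y}.
Proof.
move=> x y; apply: gr_incl_inj; rewrite cE !gr_inclB !cE.
by rewrite mulrBr mulrBl.
Qed.

Let cM : monoid_morphism c.
Proof.
split=> [|x y]; apply: gr_incl_inj; rewrite ?cE ?gr_incl1 ?mulr1 ?deltaVr //.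
by rewrite !gr_inclM !cE !mulrA deltaVK.
Qed.

Lemma conj_morphism : {morph c : x y / x - y} * monoid_morphism c.
Proof. by []. Qed.
End Conj.

Lemma gr_conjB g : {morph gr_conj g : x y / x - y}.
Proof. exact: (conj_morphism (gr_incl_conj g)).1. Qed.

HB.instance Definition _ g :=
  GRing.isZmodMorphism.Build (group_ring K N) (group_ring K N)
    (gr_conj g) (gr_conjB g).

Lemma gr_conj_monoid g : monoid_morphism (gr_conj g).
Proof. exact: (conj_morphism (gr_incl_conj g)).2. Qed.

HB.instance Definition _ g :=
  GRing.isMonoidMorphism.Build (group_ring K N) (group_ring K N)
    (gr_conj g) (gr_conj_monoid g).

Lemma gr_conjM g h f : gr_conj g (gr_conj h f) = gr_conj (g * h)%g f.
Proof.
move: (gr_incl_conj g) (gr_incl_conj h) (gr_incl_conj (g * h)%g).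
move: (gr_conj g) (gr_conj h) (gr_conj (g * h)%g) => c d e cE dE eE.
by apply: gr_incl_inj; rewrite cE dE eE invgM !deltaM !mulrA.
Qed.

Lemma gr_conj1 f : gr_conj 1%g f = f.
Proof.
by apply: gr_incl_inj; rewrite gr_incl_conj invg1 delta1 mul1r mulr1.
Qed.

Variable sigma : normalized_section E.

Definition ext_omega (h k : H) : N :=
  ext_lift (sigma h * sigma k * (sigma (h * k))^-1)%g.

Lemma ext_omegaE h k :
  ext_incl E (ext_omega h k) = (sigma h * sigma k * (sigma (h * k))^-1)%g.
Proof. by rewrite ext_liftK // !gmulfM gmorphV !sec_quo mulgV. Qed.

Definition ext_act (h : H) : {rmorphism group_ring K N -> group_ring K N} :=
  gr_conj (sigma h).

Definition ext_coc (h k : H) : group_ring K N := delta K (ext_omega h k).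

Lemma ext_act_bij h : bijective (ext_act h).
Proof.
exists (gr_conj (sigma h)^-1%g) => f; rewrite /= gr_conjM.
  by rewrite mulVg gr_conj1.
by rewrite mulgV gr_conj1.
Qed.

Lemma ext_coc_unit h k :
  exists v, ext_coc h k * v = 1 /\ v * ext_coc h k = 1.
Proof. by exists (delta K (ext_omega h k)^-1%g); rewrite deltaVr deltaVl. Qed.

Lemma gr_incl_coc h k : gr_incl (ext_coc h k) =
  delta K (sigma h) * delta K (sigma k) * delta K (sigma (h * k))^-1%g.
Proof. by rewrite gr_incl_delta ext_omegaE !deltaM. Qed.

Lemma ext_act_comp h k a :
  ext_act h (ext_act k a) * ext_coc h k =
  ext_coc h k * ext_act (h * k)%g a.
Proof.
move: (gr_incl_conj (sigma h)) (gr_incl_conj (sigma k)).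
move: (gr_incl_conj (sigma (h * k)%g)) (gr_incl_coc h k); rewrite /=.
move: (gr_conj (sigma (h * k)%g)) (gr_conj (sigma h)) (gr_conj (sigma k)).
move: (ext_coc h k) => w e c d eE wE cE dE.
apply: gr_incl_inj; rewrite !gr_inclM wE cE dE eE.
by apply: conj_cocycle; exact: deltaVl.
Qed.

Lemma ext_cocycle h k l :
  ext_coc h k * ext_coc (h * k)%g l =
  ext_act h (ext_coc k l) * ext_coc h (k * l)%g.
Proof.
apply: gr_incl_inj; rewrite !gr_inclM !gr_incl_conj !gr_incl_coc.
rewrite -!deltaM; congr (delta K _).
by rewrite !mulgA !mulgVK.
Qed.

Lemma ext_act1 a : ext_act 1%g a = a.
Proof. by rewrite /= sec1 gr_conj1. Qed.

Lemma ext_coc1l h : ext_coc 1%g h = 1.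
Proof.
by apply: gr_incl_inj; rewrite gr_incl_coc sec1 mul1g delta1 mul1r deltaVr gr_incl1.
Qed.

Lemma ext_coc1r h : ext_coc h 1%g = 1.
Proof.
by apply: gr_incl_inj; rewrite gr_incl_coc sec1 mulg1 delta1 mulr1 deltaVr gr_incl1.
Qed.

Definition ext_crossed_system : crossed_system (group_ring K N) H :=
  CrossedSystem ext_act_bij ext_coc_unit ext_act_comp ext_cocycle
    ext_act1 ext_coc1l ext_coc1r.

End Extension.

(* Main.v *)
Require Import Defs.
From mathcomp Require Import all_boot all_order all_algebra.
From mathcomp Require Import finmap complex reals monalg.

Import GRing.Theory.
Local Open Scope ring_scope.

(* By the unique product property, some h0 has exactly one factorisation       *)
(* h0 = a b with a and b in the supports of x and y.  The coefficient of x y   *)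
(* at h0 is then the single term x_a S(a)(y_b) w(a, b), nonzero since S(a) is  *)
(* injective and w(a, b) is a unit.                                            *)

(** The argument is run for an arbitrary crossed system over a domain [A]; the group extension
    enters only at the end, through [ext_crossed_system]. [mcoeff_crossed_productM_unique] isolates
    the surviving term and [crossed_product_domain] shows that it is nonzero. *)

Lemma mcoeff_crossed_productM (A : nzRingType) (H : groupType)
    (s : crossed_system A H) (x y : crossed_product s) (h0 : H) :
  (x * y)@_h0 = \sum_(h <- msupp x) \sum_(k <- msupp y)
    (x@_h * cs_act s h y@_k * cs_coc s h k) *+ ((h * k)%g == h0).
Proof.
rewrite -[x * y]/(crossed_product_mul x y) /crossed_product_mul.
rewrite (raddf_sum (mcoeff h0)); apply: eq_bigr => h _.
rewrite (raddf_sum (mcoeff h0)); apply: eq_bigr => k _.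
exact: mcoeffU.
Qed.

Lemma mcoeff_crossed_productM_unique (A : nzRingType) (H : groupType)
    (s : crossed_system A H) (x y : crossed_product s) (a b : H) :
  a \in msupp x -> b \in msupp y ->
  (forall h k, h \in msupp x -> k \in msupp y ->
    (h * k = a * b)%g -> (h, k) = (a, b)) ->
  (x * y)@_(a * b)%g = x@_a * cs_act s a y@_b * cs_coc s a b.
Proof.
move=> ax yb uniq_ab; rewrite mcoeff_crossed_productM.
rewrite (big_fsetD1 a) //= (big_fsetD1 b) //= eqxx mulr1n.
(* In the row [h = a], uniqueness rules out every [k] other than [b]. *)
rewrite big_seq big1 => [|k]; last first.
  rewrite !inE => /andP[kb yk]; case: eqP => // /(uniq_ab _ _ ax yk)[kE].
  by rewrite kE eqxx in kb.
(* The rows [h != a] never reach the product [a * b]. *)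
rewrite addr0 big_seq big1 ?addr0 // => h.
rewrite !inE => /andP[ha xh]; rewrite big_seq big1 // => k yk.
case: eqP => // /(uniq_ab _ _ xh yk)[hE _].
by rewrite hE eqxx in ha.
Qed.

Lemma crossed_product_domain (A : nzRingType) (H : groupType)
    (s : crossed_system A H) :
  is_domain A -> unique_product_group H -> is_domain (crossed_product s).
Proof.
move=> [_ domA] upH; split=> [|x y x0 y0]; first exact: oner_neq0.
have supp0 (z : crossed_product s) : z != 0 -> msupp z != fset0.
  apply: contra => /eqP z_supp; apply/eqP/malgP => h.
  by rewrite mcoeff0 mcoeff_outdom // z_supp.
have [h0 [[a b] [[/= ax yb ->] uniq_ab]]] := upH _ _ (supp0 x x0) (supp0 y y0).
apply/negP => /eqP xy0.
have : (x * y)@_(a * b)%g = 0 by rewrite xy0 mcoeff0.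
rewrite mcoeff_crossed_productM_unique // => [|h k xh yk hk]; last first.
  by apply/esym/uniq_ab; split.
(* The right inverse [v] cancels the cocycle value, leaving a vanishing product of two elements of
   [A] for [domA] to refute. *)
have [v [cv _]] := cs_coc_unit s a b.
move=> /(congr1 ( *%R^~ v)); rewrite /= -mulrA cv mulr1 mul0r.
apply/eqP/domA; first by rewrite mcoeff_neq0.
apply/eqP => Sy0; have /negP[] : y@_b != 0 by rewrite mcoeff_neq0.
by apply/eqP/(bij_inj (cs_act_bij s a)); rewrite Sy0 rmorph0.
Qed.

Theorem theorem3p4 (R : realType) (N G H : groupType)
    (E : group_extension N G H) (sigma : normalized_section E) :
  is_domain (group_ring R[i] N) ->
  unique_product_group H ->
  is_domain (crossed_product (ext_crossed_system R[i] sigma)).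
Proof. exact: crossed_product_domain. Qed.
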